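(* Let $s\ge 1$ be an integer and let $\lambda,\mu,\nu\in\mathbb{C}$ be such that $\frac{2^\mu t^\nu}{\lambda e^t+1}$ has a power series expansion in $t$ at $t=0$. Then for each pair of positive integers $c,d$, all integers $n\ge 0$, all $m\in\mathbb{N}=\{1,2,\dots\}$ and all $x,y,X,Y\in\mathbb{C}$, the 2-variable generalized Laguerre Apostol type polynomials satisfy $$\sum_{k=0}^n\binom{n}{k}\sum_{i=0}^{c-1}\sum_{j=0}^{d-1}(-1)^{i+j}\lambda^{i+j}c^k d^{n-k}\,{}_{{}_sL}\mathcal{F}_k^{(m)}\Big(d^{s}y,dx+\frac{d}{c}i;\lambda;\mu,\nu\Big)\,{}_{{}_sL}\mathcal{F}_{n-k}^{(m)}\Big(c^{s}Y,cX+\frac{c}{d}j;\lambda;\mu,\nu\Big)$$ $$=\sum_{k=0}^n\binom{n}{k}\sum_{i=0}^{d-1}\sum_{j=0}^{c-1}(-1)^{i+j}\lambda^{i+j}d^k c^{n-k}\,{}_{{}_sL}\mathcal{F}_k^{(m)}\Big(c^{s}y,cx+\frac{c}{d}i;\lambda;\mu,\nu\Big)\,{}_{{}_sL}\mathcal{F}_{n-k}^{(m)}\Big(d^{s}Y,dX+\frac{d}{c}j;\lambda;\mu,\nu\Big).$$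
   Context: Let $C_0(u)=\sum_{r=0}^\infty \frac{(-1)^r u^r}{(r!)^2}$ be the Bessel-Tricomi function of order zero. For an integer $m\ge 0$, the 2-variable generalized Laguerre Apostol type polynomials ${}_{{}_sL}\mathcal{F}_n^{(m)}(y,x;\lambda;\mu,\nu)$ of order $m$ are defined by the generating function (an identity of power series in $t$) $$\Big(\frac{2^\mu t^\nu}{\lambda e^{t}+1}\Big)^m e^{xt}\,C_0(-yt^s)=\sum_{n=0}^{\infty}{}_{{}_sL}\mathcal{F}_n^{(m)}(y,x;\lambda;\mu,\nu)\frac{t^{n}}{n!}.$$ (Note the order of arguments: first $y$, then $x$.) The base factor has a power series expansion exactly when $\nu$ is a nonnegative integer and, in the case $\lambda=-1$, $\nu\ge 1$. Here $2^\mu=e^{\mu\log 2}$, and $\lambda^0=1$. *)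

(* Defs.v *)
(* The field of complex numbers is R[i] for R : realType. *)
From HB Require Import structures.
From mathcomp Require Import all_boot all_order all_algebra.
From mathcomp Require Import complex.
From mathcomp Require Import boolp classical_sets reals sequences exp trigo.

Set Implicit Arguments.
Unset Strict Implicit.
Unset Printing Implicit Defensive.

Import Order.TTheory GRing.Theory Num.Theory.

Local Open Scope ring_scope.
Local Open Scope complex_scope.

(* A formal power series sum_n a_n t^n is its coefficient sequence a. *)
Section FormalPowerSeries.
Variable K : fieldType.
Implicit Types a b : nat -> K.

Definition fps_one : nat -> K := fun n => (n == 0%N)%:R.

Definition fps_mul a b : nat -> K :=
  fun n => \sum_(i < n.+1) a i * b (n - i)%N.

Definition fps_pow a (m : nat) : nat -> K := iter m (fps_mul a) fps_one.

(* a (u t^s); meaningful for s >= 1 *)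
Definition fps_subst_monomial a (u : K) (s : nat) : nat -> K :=
  fun n => if (s %| n)%N then a (n %/ s)%N * u ^+ (n %/ s) else 0.

(* e^{x t} *)
Definition fps_exp (x : K) : nat -> K := fun n => x ^+ n / n`!%:R.

Definition tricomi0 : nat -> K := fun r => (-1) ^+ r / (r`!%:R ^+ 2).

Fixpoint fps_quot_seq a b (n : nat) : seq K :=
  if n is n'.+1 then
    let q := fps_quot_seq a b n' in
    rcons q ((b n' - \sum_(i < n') a (n' - i)%N * q`_i) / a 0%N)
  else [::].

Lemma size_fps_quot_seq a b n : size (fps_quot_seq a b n) = n.
Proof. by elim: n => //= n IH; rewrite size_rcons IH. Qed.

Lemma nth_fps_quot_seq a b n i :
  (i < n)%N -> (fps_quot_seq a b n)`_i = (fps_quot_seq a b i.+1)`_i.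
Proof.
elim: n => // n IH; rewrite ltnS leq_eqVlt => /orP[/eqP->//|lin].
by rewrite -IH //= nth_rcons size_fps_quot_seq lin.
Qed.

Lemma fps_mul_rev a b n : fps_mul a b n = \sum_(i < n.+1) a (n - i)%N * b i.
Proof.
rewrite /fps_mul (reindex_inj rev_ord_inj) /=; apply: eq_bigr => i _.
by rewrite subSS subKn // -ltnS.
Qed.

Lemma fps_quot_exists a b : a 0%N != 0 -> exists q, fps_mul a q =1 b.
Proof.
move=> a0; exists (fun n => (fps_quot_seq a b n.+1)`_n) => n.
rewrite fps_mul_rev big_ord_recr /= nth_rcons size_fps_quot_seq ltnn eqxx subnn.
rewrite mulrCA divff // mulr1.
have -> : \sum_(i < n) a (n - i)%N * (fps_quot_seq a b i.+1)`_i =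
          \sum_(i < n) a (n - i)%N * (fps_quot_seq a b n)`_i.
  by apply: eq_bigr => i _; rewrite (nth_fps_quot_seq a b (ltn_ord i)).
by rewrite addrC subrK.
Qed.

Lemma fps_quot_unique a q q' :
  a 0%N != 0 -> fps_mul a q =1 fps_mul a q' -> q =1 q'.
Proof.
move=> a0 eqq n; elim/ltn_ind: n => n IH; move: (eqq n).
rewrite !fps_mul_rev !big_ord_recr /= subnn (eq_bigr (fun i : 'I_n =>
  a (n - i)%N * q' i)) => [/addrI /(mulfI a0)//|i _]; by rewrite IH.
Qed.

Lemma fps_mul_shift a q n : a 0%N = 0 ->
  fps_mul a q n.+1 = fps_mul (fun i => a i.+1) q n.
Proof. by move=> a0; rewrite /fps_mul big_ord_recl a0 mul0r add0r. Qed.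

End FormalPowerSeries.

Section GeneralizedLaguerreApostol.
Variable R : realType.
Local Notation C := R[i].

Definition cexp (z : C) : C :=
  (expR (complex.Re z))%:C * (cos (complex.Im z) +i* sin (complex.Im z)).

(* 2^mu = e^{mu log 2} *)
Definition two_pow (mu : C) : C := cexp (mu * (ln 2)%:C).

(* lam e^t + 1 *)
Definition apostol_den (lam : C) : nat -> C :=
  fun n => lam * fps_exp 1 n + fps_one C n.

(* b is a power series expansion of 2^mu t^nu / (lam e^t + 1), the quotient
   being read as (lam e^t + 1) * b = 2^mu t^nu in C[[t]]; the complex power
   t^nu is a power series only when nu is a natural number k. *)
Definition is_base_expansion (lam mu nu : C) (b : nat -> C) : Prop :=
  exists2 k : nat, nu = k%:R &
    forall n, fps_mul (apostol_den lam) b n = two_pow mu * (n == k)%:R.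

Definition base_expandable (lam mu nu : C) : Prop :=
  exists b, is_base_expansion lam mu nu b.

(* The expansion, which is unique (base_expansion_unique below); zero when
   there is none. *)
Definition base_series (lam mu nu : C) : nat -> C :=
  xget (fun=> 0) [set b | is_base_expansion lam mu nu b]%classic.

(* _{sL}F_n^{(m)}(y, x; lam; mu, nu) *)
Definition laguerre_apostol (s m : nat) (lam mu nu : C) (n : nat) (y x : C) : C :=
  n`!%:R * fps_mul
    (fps_mul (fps_pow (base_series lam mu nu) m) (fps_exp x))
    (fps_subst_monomial (tricomi0 C) (- y) s) n.

Lemma two_pow_neq0 mu : two_pow mu != 0.
Proof.
rewrite /two_pow /cexp mulf_neq0 //.
  by rewrite eq_complex /= eqxx andbT gt_eqF // expR_gt0.
rewrite eq_complex /=; apply/negP => /andP[/eqP c0 /eqP s0].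
by have := cos2Dsin2 (complex.Im (mu * (ln 2)%:C)); rewrite c0 s0 !expr0n /= addr0
  => /eqP; rewrite eq_sym oner_eq0.
Qed.

Lemma apostol_den0 lam : apostol_den lam 0 = lam + 1.
Proof. by rewrite /apostol_den /fps_exp /fps_one expr0 fact0 divr1 mulr1. Qed.

Lemma apostol_den1 lam : apostol_den lam 1 = lam.
Proof.
by rewrite /apostol_den /fps_exp /fps_one expr1 factS fact0 divr1 mulr1 addr0.
Qed.

Lemma base_expansion_unique lam mu nu b b' :
  is_base_expansion lam mu nu b -> is_base_expansion lam mu nu b' -> b = b'.
Proof.
move=> [k -> bE] [k' kE b'E]; apply/funext.
have ? : k = k' by apply/eqP; rewrite -(eqr_nat C); exact/eqP.
subst k'; have eqb : fps_mul (apostol_den lam) b =1 fps_mul (apostol_den lam) b'.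
  by move=> n; rewrite bE b'E.
have [d0|d0] := eqVneq (apostol_den lam 0) 0; last exact: fps_quot_unique d0 eqb.
apply: (@fps_quot_unique _ (fun i => apostol_den lam i.+1)) => [|n].
  rewrite apostol_den1; apply/eqP => lam0; move: d0.
  by rewrite apostol_den0 lam0 add0r => /eqP; rewrite oner_eq0.
by rewrite -!fps_mul_shift.
Qed.

Lemma base_expandableP lam mu nu :
  base_expandable lam mu nu <->
  exists2 k : nat, nu = k%:R & (lam = -1 -> (1 <= k)%N).
Proof.
split=> [[b [k nuE bE]]|[k nuE kP]].
  exists k => // lamE; rewrite lt0n; apply/eqP => k0.
  have /eqP := bE 0%N; rewrite /fps_mul big_ord1 apostol_den0 lamE addNr mul0r.
  by rewrite k0 mulr1 eq_sym (negPf (two_pow_neq0 mu)).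
have [d0|d0] := eqVneq (apostol_den lam 0) 0; last first.
  have [b bE] := fps_quot_exists (fun n => two_pow mu * (n == k)%:R) d0.
  by exists b, k.
have lamE : lam = -1 by apply/eqP; rewrite -addr_eq0 -apostol_den0; exact/eqP.
have d1 : apostol_den lam 1 != 0 by rewrite apostol_den1 lamE oppr_eq0 oner_eq0.
have [b bE] := @fps_quot_exists _ (fun i => apostol_den lam i.+1)
  (fun n => two_pow mu * (n.+1 == k)%:R) d1.
exists b, k => // -[|n]; last by rewrite fps_mul_shift.
by rewrite /fps_mul big_ord1 d0 mul0r eq_sym gtn_eqF ?mulr0 ?kP.
Qed.

End GeneralizedLaguerreApostol.

(* Main.v *)
(* Multiplying the n-th coefficient by u^n substitutes u t for t, a ring
   endomorphism of K[[t]].  Up to the factor n!, the (i, j)-term of the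
   left-hand side, summed over k, is therefore the coefficient of t^n in
     B(ct)^m B(dt)^m e^{(cd(x+X) + di + cj)t} C_0(-(cd)^s y t^s) C_0(-(cd)^s Y t^s)
   times (-lambda)^{i+j}, where B is the base factor; the (j, i)-term of the
   right-hand side is the same. *)
Require Import Defs.
From mathcomp Require Import all_boot all_order all_algebra.
From mathcomp Require Import complex.
From mathcomp Require Import boolp classical_sets reals sequences exp trigo.
From mathcomp Require Import ring.

Set Implicit Arguments.
Unset Strict Implicit.
Unset Printing Implicit Defensive.

Import Order.TTheory GRing.Theory Num.Theory.
Local Open Scope ring_scope.
Local Open Scope complex_scope.

Section FormalPowerSeriesAlgebra.
Variable K : fieldType.
Implicit Types (a b e : nat -> K) (u x y : K).

(** The coefficient of index [n] involves only coefficients of index at most [n], so truncation to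
    polynomials loses nothing; ring laws can then be transferred from [{poly K}]. *)
Lemma fps_mul_poly N a b n : (n < N)%N ->
  fps_mul a b n = (\poly_(i < N) a i * \poly_(i < N) b i)`_n.
Proof.
move=> ltnN; rewrite coefM; apply: eq_bigr => i _; rewrite !coef_poly.
by rewrite (leq_ltn_trans (leq_ord i) ltnN) (leq_ltn_trans (leq_subr i n) ltnN).
Qed.

Lemma fps_mulC : commutative (@fps_mul K).
Proof.
by move=> a b; apply/funext => n; rewrite !(fps_mul_poly _ _ (ltnSn n)) mulrC.
Qed.

Lemma fps_mulA : associative (@fps_mul K).
Proof.
move=> a b e; apply/funext => n; pose T f := \poly_(i < n.+1) f i : {poly K}.
(* One truncation order serves both levels: the inner products are read only at indices at most
   [n]. *)
transitivity (T a * (T b * T e))`_n.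
  rewrite coefM; apply: eq_bigr => i _.
  by rewrite coef_poly ltn_ord -fps_mul_poly // ltnS leq_subr.
rewrite mulrA coefM; apply: eq_bigr => i _.
by rewrite coef_poly ltnS leq_subr -fps_mul_poly.
Qed.

Lemma fps_mulACA : interchange (@fps_mul K) (@fps_mul K).
Proof.
by move=> a b a' b'; rewrite -!fps_mulA (fps_mulA b) (fps_mulC b) -fps_mulA.
Qed.

Definition fps_dilate u a : nat -> K := fun n => u ^+ n * a n.

Lemma fps_dilateM u a b :
  fps_dilate u (fps_mul a b) = fps_mul (fps_dilate u a) (fps_dilate u b).
Proof.
apply/funext => n; rewrite /fps_dilate /fps_mul mulr_sumr.
apply: eq_bigr => i _; rewrite mulrACA -exprD subnKC //; exact: leq_ord.
Qed.

Lemma fps_dilate_exp u x : fps_dilate u (fps_exp x) = fps_exp (u * x).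
Proof. by apply/funext => n; rewrite /fps_dilate /fps_exp exprMn mulrA. Qed.

Lemma fps_dilate_subst_monomial u a x s :
  fps_dilate u (fps_subst_monomial a x s) =
  fps_subst_monomial a (u ^+ s * x) s.
Proof.
apply/funext => n; rewrite /fps_dilate /fps_subst_monomial.
case: ifP => [sn|_]; last by rewrite mulr0.
by rewrite exprMn -exprM (mulnC s) divnK // mulrCA.
Qed.

(** The binomial theorem divided by [n!]; characteristic zero makes the factorials and binomials
    invertible. *)
Lemma fps_expD x y : [pchar K] =i pred0 ->
  fps_mul (fps_exp x) (fps_exp y) = fps_exp (x + y).
Proof.
move=> /pcharf0P char0; apply/funext => n.
have fact_neq0 k : k`!%:R != 0 :> K by rewrite char0 -lt0n fact_gt0.
rewrite /fps_exp addrC exprDn mulr_suml; apply: eq_bigr => i _.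
have le_in : (i <= n)%N := leq_ord i.
rewrite -(bin_fact le_in) !natrM -mulr_natr.
have bin_neq0 : 'C(n, i)%:R != 0 :> K by rewrite char0 -lt0n bin_gt0.
by field; rewrite bin_neq0 !fact_neq0.
Qed.

(** Passes from exponential generating functions to ordinary ones, using
    ['C(n, k) * (k! * (n - k)!) = n!]. *)
Lemma sum_binomial_fps_mul a b n :
  \sum_(k < n.+1) 'C(n, k)%:R * ((k`!%:R * a k) * ((n - k)`!%:R * b (n - k)%N))
  = n`!%:R * fps_mul a b n.
Proof.
rewrite /fps_mul mulr_sumr; apply: eq_bigr => k _.
by rewrite mulrACA !mulrA -!natrM -mulnA bin_fact // leq_ord.
Qed.

End FormalPowerSeriesAlgebra.

Section DilatedLaguerreApostol.
Variable R : realType.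
Variables (s m : nat) (lam mu nu : R[i]).
Local Notation F := (laguerre_apostol s m lam mu nu).
Local Notation B := (fps_pow (base_series lam mu nu) m).
Local Notation T y := (fps_subst_monomial (tricomi0 R[i]) (- y) s).

(** Substituting [u t] for [t] in the generating function; [y] acquires [u ^+ s] because it
    accompanies [t^s]. *)
Lemma laguerre_apostol_dilate u n y x :
  u ^+ n * F n y x =
  n`!%:R * fps_mul (fps_mul (fps_dilate u B) (fps_exp (u * x)))
                   (T (u ^+ s * y)) n.
Proof.
by rewrite -mulrN -fps_dilate_exp -fps_dilate_subst_monomial -!fps_dilateM mulrCA.
Qed.

Lemma laguerre_apostol_convolution u v n y x Y X :
  \sum_(k < n.+1) 'C(n, k)%:R *
    (u ^+ k * v ^+ (n - k) * F k y x * F (n - k) Y X) =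
  n`!%:R * fps_mul
    (fps_mul (fps_mul (fps_dilate u B) (fps_dilate v B))
             (fps_exp (u * x + v * X)))
    (fps_mul (T (u ^+ s * y)) (T (v ^+ s * Y))) n.
Proof.
rewrite -fps_expD; last exact: pchar_num.
(* Two interchanges regroup the six factors into a generating function dilated by [u] times one
   dilated by [v]. *)
rewrite (fps_mulACA (fps_dilate u B)).
rewrite (fps_mulACA (fps_mul (fps_dilate u B) _)) -sum_binomial_fps_mul.
by apply: eq_bigr => k _; rewrite -!laguerre_apostol_dilate -mulrA mulrACA.
Qed.

End DilatedLaguerreApostol.

Theorem corollary3p4 (R : realType) (s : nat) (hs : (1 <= s)%N)
    (lam mu nu : R[i]) (hbase : base_expandable lam mu nu)
    (c d : nat) (hc : (0 < c)%N) (hd : (0 < d)%N)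
    (n m : nat) (hm : (1 <= m)%N) (x y X Y : R[i]) :
  \sum_(k < n.+1) 'C(n, k)%:R *
    \sum_(i < c) \sum_(j < d)
      (-1) ^+ (i + j) * lam ^+ (i + j) * c%:R ^+ k * d%:R ^+ (n - k) *
      laguerre_apostol s m lam mu nu k
        (d%:R ^+ s * y) (d%:R * x + d%:R / c%:R * i%:R) *
      laguerre_apostol s m lam mu nu (n - k)
        (c%:R ^+ s * Y) (c%:R * X + c%:R / d%:R * j%:R)
  =
  \sum_(k < n.+1) 'C(n, k)%:R *
    \sum_(i < d) \sum_(j < c)
      (-1) ^+ (i + j) * lam ^+ (i + j) * d%:R ^+ k * c%:R ^+ (n - k) *
      laguerre_apostol s m lam mu nu k
        (c%:R ^+ s * y) (c%:R * x + c%:R / d%:R * i%:R) *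
      laguerre_apostol s m lam mu nu (n - k)
        (d%:R ^+ s * Y) (d%:R * X + d%:R / c%:R * j%:R).
Proof.
have cn0 : c%:R != 0 :> R[i] by rewrite pnatr_eq0 -lt0n.
have dn0 : d%:R != 0 :> R[i] by rewrite pnatr_eq0 -lt0n.
under eq_bigr => k _ do
  (rewrite mulr_sumr; under eq_bigr => i _ do rewrite mulr_sumr).
under [RHS]eq_bigr => k _ do
  (rewrite mulr_sumr; under eq_bigr => i _ do rewrite mulr_sumr).
(* The sums over [k] move innermost; the last exchange on the right then pairs its [(j, i)]-term
   with the [(i, j)]-term on the left. *)
rewrite exchange_big [RHS]exchange_big /=.
under eq_bigr => i _ do rewrite exchange_big /=.
under [RHS]eq_bigr => i _ do rewrite exchange_big /=.
rewrite [RHS]exchange_big /=; apply: eq_bigr => i _; apply: eq_bigr => j _.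
have factor_sign (f g p q e : 'I_n.+1 -> R[i]) (z : R[i]) :
    \sum_(k < n.+1) f k * (z * p k * q k * g k * e k) =
    z * \sum_(k < n.+1) f k * (p k * q k * g k * e k).
  by rewrite mulr_sumr; apply: eq_bigr => k _; rewrite -!mulrA mulrCA.
rewrite !factor_sign (addnC j i); congr (_ * _).
rewrite !laguerre_apostol_convolution (fps_mulC (fps_dilate d%:R _)).
congr (_ * fps_mul (fps_mul _ (fps_exp _)) (fps_mul _ _) n).
(* Both exponents equal [cd(x + X) + di + cj]. *)
- by field; rewrite cn0 dn0.
- by rewrite mulrCA.
- by rewrite mulrCA.
Qed.
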